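(* Let $\mathbf{W}\in\mathbb{R}^{N\times N}$ be the symmetric weighted adjacency matrix of a finite undirected weighted graph with node set $\mathcal{N}=\{1,\dots,N\}$, and let $\rho(\mathbf{W})$ be its spectral radius. Let $(\alpha_i^{(M)})_{i=0}^\infty$ be a sequence of nonnegative reals with $\sum_{i=0}^\infty\alpha_i^{(M)}\rho(\mathbf{W})^i<\infty$. Consider the hypothesis set of functions $\mathcal{N}\to\mathbb{R}$ $$H=\left\{x\mapsto \boldsymbol{w}^\top\boldsymbol{\psi}_{K_\alpha}(x)\;:\;|\alpha_i|\le\alpha_i^{(M)}\ \text{for all } i\ge 0,\ \|\boldsymbol{w}\|_2\le 1\right\},$$ where $\boldsymbol{\alpha}=(\alpha_i)_{i=0}^\infty$ ranges over real sequences for which $\mathbf{K}_{\boldsymbol{\alpha}}(\mathbf{W})=\sum_{i=0}^\infty\alpha_i\mathbf{W}^i$ is positive semidefinite (so that it is the Gram matrix of a kernel), and $\boldsymbol{w}$ ranges over the corresponding reproducing kernel Hilbert space $\mathbb{H}_{K_\alpha}$. Then for every fixed sample $S=(x_i)_{i=1}^m$ of nodes, the empirical Rademacher complexity of $H$ satisfies $$\widehat{\mathcal{R}}(H)\le\sqrt{\frac1m\sum_{i=0}^\infty\alpha_i^{(M)}\rho(\mathbf{W})^i}.$$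
   Context: For a real sequence $\boldsymbol{\alpha}$ the matrix $\mathbf{K}_{\boldsymbol{\alpha}}(\mathbf{W})=\sum_{k=0}^\infty\alpha_k\mathbf{W}^k$ (with $\mathbf{W}^0$ the identity) defines a function $K_{\boldsymbol{\alpha}}^{\mathcal{G}}:\mathcal{N}\times\mathcal{N}\to\mathbb{R}$, $K_{\boldsymbol{\alpha}}^{\mathcal{G}}(i,j)=[\mathbf{K}_{\boldsymbol{\alpha}}(\mathbf{W})]_{ij}$, which is a kernel when the matrix is positive semidefinite. $\boldsymbol{\psi}_{K_\alpha}:\mathcal{N}\to\mathbb{H}_{K_\alpha}$ denotes the feature map into the reproducing kernel Hilbert space induced by this kernel, so that $\boldsymbol{\psi}_{K_\alpha}(x)^\top\boldsymbol{\psi}_{K_\alpha}(y)=K_{\boldsymbol{\alpha}}^{\mathcal{G}}(x,y)$; here $\boldsymbol{w}^\top\boldsymbol{\psi}$ and $\|\boldsymbol{w}\|_2$ denote the inner product and norm of $\mathbb{H}_{K_\alpha}$. The spectral radius is $\rho(\mathbf{W})=\max\{|\lambda|:\lambda\text{ an eigenvalue of }\mathbf{W}\}$. For a fixed sample $S=(x_i)_{i=1}^m$, the empirical Rademacher complexity is $$\widehat{\mathcal{R}}(H)=\frac1m\,\mathbb{E}_{\boldsymbol{\sigma}}\left[\sup_{h\in H}\sum_{i=1}^m\sigma_i h(x_i)\right],$$ where $\boldsymbol{\sigma}=(\sigma_1,\dots,\sigma_m)$ has i.i.d. entries uniform on $\{+1,-1\}$. *)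

(* Defs.v *)
From HB Require Import structures.
From mathcomp Require Import all_boot all_order all_algebra complex.
From mathcomp Require Import all_classical all_reals all_analysis.

Set Implicit Arguments.
Unset Strict Implicit.
Unset Printing Implicit Defensive.

Import Order.TTheory GRing.Theory Num.Theory.
Import numFieldNormedType.Exports.

Local Open Scope classical_set_scope.
Local Open Scope ring_scope.

(* The set of eigenvalues is finite, so for N > 0 this supremum is the maximum
   of the moduli of the complex eigenvalues of W. *)
Definition spectral_radius (R : realType) (N : nat) (W : 'M[R]_N) : R :=
  sup [set ComplexField.Normc.normc l
      | l in [set l : R[i] | eigenvalue (map_mx (real_complex R) W) l]].

Definition power_series_terms (R : realType) (N : nat) (a : R^nat)
    (W : 'M[R]_N) : ('M[R]_N)^nat :=
  fun k => a k *: W ^+ k.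

Definition kernel_mx (R : realType) (N : nat) (a : R^nat) (W : 'M[R]_N) :
    'M[R]_N :=
  limn (series (power_series_terms a W)).

Definition possemidef (R : realType) (N : nat) (K : 'M[R]_N) : Prop :=
  K^T = K /\ forall v : 'cV[R]_N, 0 <= (v^T *m K *m v) 0 0.

(* Reproducing kernel Hilbert space of a positive semidefinite K on the finite
   set 'I_N. A function f : 'I_N -> R is encoded as the row vector of its
   values, so that the kernel section K(x, .) is row x K and the span of the
   kernel sections, which is finite-dimensional and hence already complete, is
   the row space of K. *)
Definition feature_map (R : realType) (N : nat) (K : 'M[R]_N) (x : 'I_N) :
    'rV[R]_N :=
  row x K.

Definition rkhs (R : realType) (N : nat) (K : 'M[R]_N) : set 'rV[R]_N :=
  [set f | (f <= K)%MS].

(* For f = \sum_i c_i K(i, .) and g = \sum_j d_j K(j, .), the inner product is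
   \sum_(i, j) c_i d_j K(i, j). Here c := f *m pinvmx K is one choice of
   coefficients; rkhs_dotE shows that the value does not depend on it. *)
Definition rkhs_dot (R : realType) (N : nat) (K : 'M[R]_N) (f g : 'rV[R]_N) :
    R :=
  ((f *m pinvmx K) *m K *m (g *m pinvmx K)^T) 0 0.

Definition rkhs_norm (R : realType) (N : nat) (K : 'M[R]_N) (f : 'rV[R]_N) :
    R :=
  Num.sqrt (rkhs_dot K f f).

Lemma rkhs_dotE (R : realType) (N : nat) (K : 'M[R]_N) (c d : 'rV[R]_N) :
  possemidef K -> rkhs_dot K (c *m K) (d *m K) = (c *m K *m d^T) 0 0.
Proof.
move=> [Ksym _]; rewrite /rkhs_dot mulmxKpV ?submxMl//.
set e := d *m K *m pinvmx K.
have eK : e *m K = d *m K by rewrite mulmxKpV ?submxMl.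
have KeT : K *m e^T = K *m d^T by rewrite -[in LHS]Ksym -[in RHS]Ksym -!trmx_mul eK.
by rewrite -!mulmxA KeT.
Qed.

Lemma rkhs_reproducing (R : realType) (N : nat) (K : 'M[R]_N) (f : 'rV[R]_N)
    (x : 'I_N) :
  possemidef K -> rkhs K f -> rkhs_dot K f (feature_map K x) = f 0 x.
Proof.
move=> psdK /submxP[c ->]; rewrite /feature_map rowE rkhs_dotE//.
by rewrite trmx_delta -colE mxE.
Qed.

Lemma feature_map_dot (R : realType) (N : nat) (K : 'M[R]_N) (x y : 'I_N) :
  possemidef K -> rkhs_dot K (feature_map K x) (feature_map K y) = K x y.
Proof.
by move=> psdK; rewrite rkhs_reproducing// ?mxE//; exact: row_sub.
Qed.

Lemma rkhs_dot_ge0 (R : realType) (N : nat) (K : 'M[R]_N) (f : 'rV[R]_N) :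
  possemidef K -> 0 <= rkhs_dot K f f.
Proof. by case=> _ /(_ (f *m pinvmx K)^T); rewrite trmxK. Qed.

(* With the bound |a i| <= aM i and a convergent majorant the convergence clause
   always holds; it is stated so that kernel_mx is only read at sequences for
   which the limit exists. *)
Definition hypothesis_set (R : realType) (N : nat) (W : 'M[R]_N) (aM : R^nat) :
    set ('I_N -> R) :=
  [set h | exists (a : R^nat) (w : 'rV[R]_N),
     [/\ forall i, `|a i| <= aM i,
         cvgn (series (power_series_terms a W)),
         possemidef (kernel_mx a W),
         rkhs (kernel_mx a W) w /\ rkhs_norm (kernel_mx a W) w <= 1 &
         h = fun x => rkhs_dot (kernel_mx a W) w
                               (feature_map (kernel_mx a W) x)]].

(* Expectation over m independent uniform signs: by independence each of the
   2 ^ m sign patterns has probability \prod_(i < m) 1/2. *)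
Definition rademacher_expectation (R : realType) (m : nat)
    (F : ('I_m -> R) -> \bar R) : \bar R :=
  (\sum_(s : {ffun 'I_m -> bool})
     (\prod_(i < m) 2^-1)%R%:E * F (fun i => ((-1) ^+ s i)%R))%E.

(* Valued in \bar R so that an unbounded supremum is +oo. *)
Definition empirical_rademacher (R : realType) (T : Type) (m : nat)
    (S : 'I_m -> T) (H : set (T -> R)) : \bar R :=
  ((m%:R^-1)%R%:E * rademacher_expectation (fun sigma : 'I_m -> R =>
     ereal_sup [set (\sum_(i < m) sigma i * h (S i))%R%:E | h in H]))%E.

(* Main.v *)
(* For a fixed sign pattern s put v = \sum_i s_i e_(x_i). By the reproducing
   property and Cauchy-Schwarz, every hypothesis of the unit ball of K satisfies
   \sum_i s_i h(x_i) <= sqrt (v K v^T). Diagonalizing W unitarily over the complex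
   numbers gives |v W^k v^T| <= rho(W)^k |v|^2, hence v K v^T <= B |v|^2 with
   B = \sum_k aM_k rho(W)^k, uniformly in the coefficients. Since the mean of
   |v|^2 over the sign patterns is m, Jensen's inequality for the square root
   bounds the complexity by sqrt (B m) / m. *)

Require Import Defs.
From HB Require Import structures.
From mathcomp Require Import all_boot all_order all_algebra complex ring lra.
From mathcomp Require Import all_classical all_reals all_analysis.

Set Implicit Arguments.
Unset Strict Implicit.
Unset Printing Implicit Defensive.

Import Order.TTheory GRing.Theory Num.Theory.
Import numFieldNormedType.Exports.

Local Open Scope classical_set_scope.
Local Open Scope ring_scope.

(** A supremum dominates its set only once that set is bounded above; the sum of the moduli of all
    roots of the characteristic polynomial is such a bound. *)
Lemma normc_eigenvalue_le (R : realType) (N : nat) (W : 'M[R]_N) (l : R[i]) :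
  eigenvalue (map_mx (real_complex R) W) l ->
  ComplexField.Normc.normc l <= spectral_radius W.
Proof.
move=> lW; apply: ub_le_sup; last by exists l.
have [rs charE] := closed_field_poly_normal (char_poly (map_mx (real_complex R) W)).
exists (\sum_(z <- rs) ComplexField.Normc.normc z) => _ [z zW <-].
move: zW; rewrite /= eigenvalue_root_char charE (monicP (char_poly_monic _)).
rewrite scale1r root_prod_XsubC => zrs.
rewrite (big_rem z)//= lerDl sumr_ge0// => -[a b] _; exact: sqrtr_ge0.
Qed.

Lemma spectral_radius_ge0 (R : realType) (N : nat) (W : 'M[R]_N) :
  0 <= spectral_radius W.
Proof.
(* Without eigenvalues, as for [N = 0], the supremum is over the empty set and equals 0 by
   convention. *)
have [E0|] := eqVneq [set l : R[i] | eigenvalue (map_mx (real_complex R) W) l] set0.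
  by rewrite /spectral_radius E0 image_set0 sup0.
move=> /set0P[l lW]; apply: le_trans (normc_eigenvalue_le lW).
by case: l {lW} => a b; exact: sqrtr_ge0.
Qed.

(** In a unitary eigenbasis the form is the sum of [d 0 j ^+ k * |y 0 j| ^+ 2], where [|d 0 j|] is
    at most the spectral radius and the [|y 0 j| ^+ 2] add up to [v *m v^T]. *)
Lemma symmetric_quad_exp_le (R : realType) (N : nat) (W : 'M[R]_N)
    (v : 'rV[R]_N) (k : nat) :
  W^T = W ->
  `|(v *m W ^+ k *m v^T) 0 0| <= spectral_radius W ^+ k * (v *m v^T) 0 0.
Proof.
move=> W_sym; set rho := spectral_radius W.
pose toC := real_complex R; pose Wc := map_mx toC W; pose vc := map_mx toC v.
have conjC_toC x : Num.conj (toC x) = toC x by exact: conjc_real.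
have conj_map p q (A : 'M[R]_(p, q)) : map_mx Num.conj (map_mx toC A) = map_mx toC A.
  by apply/matrixP => i j; rewrite !mxE conjC_toC.
have Wc_normal : Wc \is normalmx.
  by apply/normalmxP; rewrite /Wc map_trmx W_sym conj_map.
have [P [d [P_unitary WcE]]] : exists (P : 'M[R[i]]_N) (d : 'rV[R[i]]_N),
    P \is unitarymx /\ Wc = invmx P *m diag_mx d *m P.
  exists (spectralmx Wc), (spectral_diag Wc); split; first exact: spectral_unitarymx.
  by apply/orthomx_spectralP.
have P_unit : P \in unitmx := unitarymx_unit P_unitary.
have d_le j : `|d 0 j| <= toC rho.
  rewrite -[X in X <= _]/(toC (ComplexField.Normc.normc (d 0 j))) lecR.
  (* From [P *m Wc = diag_mx d *m P], row [j] of [P] is a left eigenvector for [d 0 j]; it is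
     nonzero since [P] is invertible. *)
  apply: normc_eigenvalue_le; apply/eigenvalueP; exists (row j P).
    rewrite -/toC -/Wc WcE -!row_mul !mulmxA mulmxV// mul1mx row_mul.
    by apply/rowP => i; rewrite row_diag_mx -scalemxAl -rowE !mxE.
  apply/eqP => P0; have : row_free P by rewrite row_free_unit.
  move=> /row_freeP[B PB]; have := congr1 (fun M => (row j M) 0 j) PB.
  by rewrite /= row_mul P0 mul0mx !mxE eqxx => /esym/eqP; rewrite oner_eq0.
pose Dk k := diag_mx (\row_j d 0 j ^+ k).
have WkP n : map_mx toC (W ^+ n) *m invmx P = invmx P *m Dk n.
  elim: n => [|n IHn].
    rewrite expr0 map_mx1 mul1mx; apply/matrixP => i j; rewrite mul_mx_diag !mxE.
    by rewrite expr0 mulr1.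
  rewrite exprSr -[W ^+ n * W]/(W ^+ n *m W) map_mxM -/Wc WcE !mulmxA IHn.
  rewrite mulmxK// -mulmxA; congr (_ *m _).
  by apply/matrixP => i j; rewrite mul_diag_mx !mxE; case: eqP => [->|];
    rewrite ?mulr1n ?exprSr// !mulr0n mulr0.
(* Coordinates of [v] in the eigenbasis. As [v] is real and [P] unitary, [P *m vc^T] is the
   conjugate transpose of [y], which produces squared moduli. *)
pose y := vc *m invmx P.
have PvE : P *m vc^T = map_mx Num.conj y^T.
  have PK : map_mx Num.conj (map_mx Num.conj P) = P.
    by rewrite -map_mx_comp (map_mx_id (@conjCK _)).
  rewrite /y invmx_unitary// trmx_mul map_mxM/= !map_trmx trmxK PK.
  by rewrite conj_map.
have quadE : toC ((v *m W ^+ k *m v^T) 0 0) = \sum_j d 0 j ^+ k * `|y 0 j| ^+ 2.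
  transitivity ((y *m Dk k *m (P *m vc^T)) 0 0).
    rewrite /y -(mulmxA vc) -WkP -!mulmxA (mulmxA _ P) mulVmx// mul1mx.
    by rewrite mulmxA map_trmx -!map_mxM [RHS]mxE mulmxA.
  rewrite PvE mxE; apply: eq_bigr => j _.
  by rewrite mul_mx_diag !mxE normCK mulrAC mulrC mulrA.
have normE : toC ((v *m v^T) 0 0) = \sum_j `|y 0 j| ^+ 2.
  transitivity ((y *m (P *m vc^T)) 0 0).
    by rewrite /y -mulmxA (mulmxA _ P) mulVmx// mul1mx map_trmx -map_mxM [RHS]mxE.
  by rewrite PvE mxE; apply: eq_bigr => j _; rewrite !mxE normCK.
rewrite -lecR rmorphM rmorphXn/= -/toC normE.
have -> : toC `|(v *m W ^+ k *m v^T) 0 0| = `|toC ((v *m W ^+ k *m v^T) 0 0)|.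
  by rewrite normc_def/= expr0n addr0 sqrtr_sqr.
rewrite quadE mulr_sumr; apply: le_trans (ler_norm_sum _ _ _) _.
apply: ler_sum => j _; rewrite normrM normrX (ger0_norm (exprn_ge0 _ _))//.
by rewrite ler_wpM2r ?exprn_ge0// lerXn2r ?nnegrE// (le_trans _ (d_le j)).
Qed.

(** Each partial sum is bounded term by term, and the bound passes to the limit because the form is
    continuous in the matrix. The right-hand side is free of [a]. *)
Lemma kernel_quad_le (R : realType) (N : nat) (W : 'M[R]_N) (a aM : R^nat)
    (v : 'rV[R]_N) :
  W^T = W -> (forall i, `|a i| <= aM i) ->
  cvgn (series (power_series_terms a W)) ->
  cvgn (series (fun i : nat => aM i * spectral_radius W ^+ i)) ->
  (v *m kernel_mx a W *m v^T) 0 0 <=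
  limn (series (fun i : nat => aM i * spectral_radius W ^+ i)) * (v *m v^T) 0 0.
Proof.
move=> W_sym a_le a_cvg aM_cvg.
pose quad (K : 'M[R]_N) := (v *m K *m v^T) 0 0.
have quadE K : quad K = \sum_i (\sum_j v 0 j * K j i) * v 0 i.
  by rewrite /quad mxE; apply: eq_bigr => i _; rewrite !mxE.
have quad_cvg : quad (series (power_series_terms a W) n) @[n --> \oo] -->
    quad (kernel_mx a W).
  under eq_fun do rewrite quadE.
  rewrite quadE; apply: cvg_big => [|i _]; first exact: add_continuous.
  apply: cvgMr_tmp; apply: cvg_big => [|j _]; first exact: add_continuous.
  apply: cvgMl_tmp.
  have coord_cont : {for kernel_mx a W, continuous (fun M : 'M[R]_N => M j i)}.
    exact: coord_continuous.
  exact: (continuous_cvg _ coord_cont a_cvg).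
apply: (cvgr_to_le quad_cvg); apply: nearW => n.
have norm_ge0 : 0 <= (v *m v^T) 0 0.
  by rewrite mxE sumr_ge0// => i _; rewrite mxE -expr2 sqr_ge0.
have term_ge0 i : 0 <= aM i * spectral_radius W ^+ i.
  by rewrite mulr_ge0 ?exprn_ge0 ?spectral_radius_ge0// (le_trans _ (a_le i)).
apply: (@le_trans _ _
    (series (fun i : nat => aM i * spectral_radius W ^+ i) n * (v *m v^T) 0 0)).
  rewrite /quad /series/= mulmx_sumr mulmx_suml summxE mulr_suml.
  apply: ler_sum => k _; rewrite /power_series_terms -scalemxAr -scalemxAl mxE.
  apply: le_trans (ler_norm _) _; rewrite normrM -mulrA.
  by apply: ler_pM => //; exact: symmetric_quad_exp_le.
rewrite ler_wpM2r//; apply: nondecreasing_cvgn_le => //.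
exact: nondecreasing_series.
Qed.

Lemma possemidef_Cauchy_Schwarz (R : realType) (N : nat) (K : 'M[R]_N)
    (c d : 'rV[R]_N) :
  possemidef K ->
  (c *m K *m d^T) 0 0 ^+ 2 <= (c *m K *m c^T) 0 0 * (d *m K *m d^T) 0 0.
Proof.
move=> [K_sym K_psd]; pose q (x y : 'rV[R]_N) := (x *m K *m y^T) 0 0.
rewrite -/(q c d) -/(q c c) -/(q d d).
have q_ge0 x : 0 <= q x x by have := K_psd x^T; rewrite trmxK.
have qC x y : q x y = q y x.
  by rewrite /q -[x *m K *m y^T]trmxK mxE !trmx_mul trmxK K_sym mulmxA.
have qE x y : 0 <= x ^+ 2 * q c c - 2 * x * y * q c d + y ^+ 2 * q d d.
  have := q_ge0 (x *: c - y *: d).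
  suff -> : q (x *: c - y *: d) (x *: c - y *: d) =
      x ^+ 2 * q c c - x * y * q c d - x * y * q d c + y ^+ 2 * q d d.
    by rewrite (qC d c) => h; nra.
  have -> : q (x *: c - y *: d) (x *: c - y *: d) =
      ((x *: c - y *: d) *m K *m (x *: c^T - y *: d^T)) 0 0.
    by rewrite /q linearB/= !linearZ.
  rewrite /q !mulmxBl !mulmxBr -!scalemxAr -!scalemxAl.
  move: (c *m K *m c^T) (c *m K *m d^T) (d *m K *m c^T) (d *m K *m d^T).
  by move=> cc cd dc dd; rewrite !mxE; ring.
have [d0|d_gt0] := leP (q d d) 0; last first.
  (* This choice turns the form into [q d d * (q c c * q d d - q c d ^+ 2)], whose first factor is
     positive. *)
  by have := qE (q d d) (q c d); nra.
have {}d0 : q d d = 0 by apply/le_anti; rewrite d0 q_ge0.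
have [->|cd0] := eqVneq (q c d) 0; first by rewrite d0 mulr0 expr0n.
(* If [q d d = 0] but [q c d] is nonzero, this choice gives the form the value -1, a
   contradiction. *)
have := qE 1 ((q c c + 1) / (2 * q c d)); rewrite d0.
rewrite (_ : 2 * 1 * _ * _ = q c c + 1); first by lra.
by field.
Qed.

(** Pairing a function on the nodes with this vector gives its signed sum over the sample. Repeated
    nodes accumulate, so the norm may depend on the signs. *)
Definition sample_vector (R : realType) (N m : nat) (S : 'I_m -> 'I_N)
    (s : 'I_m -> R) : 'rV[R]_N :=
  \sum_i s i *: delta_mx 0 (S i).

(** Writing [w = c *m K], the reproducing property makes the left side the [K]-product of [c] and
    the sample vector; Cauchy-Schwarz then applies. *)
Lemma rkhs_ball_eval_le (R : realType) (N m : nat) (K : 'M[R]_N) (w : 'rV[R]_N)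
    (S : 'I_m -> 'I_N) (s : 'I_m -> R) :
  possemidef K -> rkhs K w -> rkhs_norm K w <= 1 ->
  \sum_i s i * rkhs_dot K w (feature_map K (S i)) <=
  Num.sqrt ((sample_vector S s *m K *m (sample_vector S s)^T) 0 0).
Proof.
move=> K_psd wK w_le1; set v := sample_vector S s.
have {wK} [c wE] := submxP wK.
have -> : \sum_i s i * rkhs_dot K w (feature_map K (S i)) = (c *m K *m v^T) 0 0.
  rewrite -wE /v /sample_vector linear_sum/= mulmx_sumr summxE; apply: eq_bigr => i _.
  rewrite rkhs_reproducing//; last by rewrite /rkhs/= wE submxMl.
  by rewrite linearZ/= -scalemxAr mxE trmx_delta -colE mxE.
have c_le1 : (c *m K *m c^T) 0 0 <= 1.
  move: w_le1; rewrite /rkhs_norm wE rkhs_dotE//.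
  by rewrite -{1}sqrtr1 ler_sqrt.
have v_ge0 : 0 <= (v *m K *m v^T) 0 0 by case: K_psd => _ /(_ v^T); rewrite trmxK.
apply: le_trans (ler_norm _) _; rewrite -sqrtr_sqr ler_sqrt//.
apply: le_trans (possemidef_Cauchy_Schwarz _ _ K_psd) _.
by rewrite -[leRHS]mul1r ler_wpM2r.
Qed.

(** Jensen's inequality, obtained from the nonnegativity of the variance. *)
Lemma weighted_mean_le_sqrt (R : realType) (I : finType) (p f : I -> R) :
  (forall i, 0 <= p i) -> \sum_i p i = 1 ->
  \sum_i p i * f i <= Num.sqrt (\sum_i p i * f i ^+ 2).
Proof.
move=> p_ge0 p1; set mu := \sum_i p i * f i.
apply: le_trans (ler_norm _) _; rewrite -sqrtr_sqr ler_sqrt; last first.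
  by apply: sumr_ge0 => i _; rewrite mulr_ge0// sqr_ge0.
have : 0 <= \sum_i p i * (f i - mu) ^+ 2.
  by apply: sumr_ge0 => i _; rewrite mulr_ge0// sqr_ge0.
suff -> : \sum_i p i * (f i - mu) ^+ 2 = \sum_i p i * f i ^+ 2 - mu ^+ 2.
  by rewrite subr_ge0.
transitivity (\sum_i (p i * f i ^+ 2 - 2 * mu * (p i * f i) + mu ^+ 2 * p i)).
  by apply: eq_bigr => i _; ring.
by rewrite big_split/= sumrB -!mulr_sumr p1 -/mu; ring.
Qed.

(** For distinct indices, flipping the sign at [i] is an involution that negates every summand, so
    the sum vanishes. *)
Lemma sum_sign_mul (R : realType) (m : nat) (i j : 'I_m) :
  \sum_(s : {ffun 'I_m -> bool}) (-1) ^+ s i * (-1) ^+ s j =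
  (2 ^ m)%:R * (i == j)%:R :> R.
Proof.
have [<-|ij] := eqVneq i j.
  under eq_bigr => s _ do rewrite -expr2 sqrr_sign.
  by rewrite sumr_const mulr1 card_ffun card_bool card_ord.
pose flip (s : {ffun 'I_m -> bool}) := [ffun k => s k (+) (k == i)].
have flipK : involutive flip.
  by move=> s; apply/ffunP => k; rewrite !ffunE -addbA addbb addbF.
rewrite mulr0; set X := LHS.
suff : X = - X by lra.
rewrite {1}/X (reindex_inj (inv_inj flipK)) -sumrN; apply: eq_bigr => s _.
by rewrite !ffunE eqxx eq_sym (negPf ij) addbF addbT signrN mulNr.
Qed.

(** Orthogonality of the signs removes every pair [i != j], even when [S i = S j], and leaves [m]
    diagonal terms. *)
Lemma sum_sign_vector_sqnorm (R : realType) (N m : nat) (S : 'I_m -> 'I_N) :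
  \sum_(s : {ffun 'I_m -> bool})
     (sample_vector S (fun i => (-1) ^+ s i : R) *m
        (sample_vector S (fun i => (-1) ^+ s i))^T) 0 0 = (2 ^ m)%:R * m%:R.
Proof.
transitivity (\sum_(s : {ffun 'I_m -> bool}) \sum_i \sum_j
    ((-1) ^+ s i * (-1) ^+ s j) * (S i == S j)%:R : R).
  apply: eq_bigr => s _; rewrite /sample_vector.
  rewrite mulmx_suml summxE; apply: eq_bigr => i _.
  rewrite linear_sum/= mulmx_sumr summxE; apply: eq_bigr => j _.
  rewrite linearZ/= -scalemxAl -scalemxAr scalerA mxE trmx_delta mul_delta_mx_cond.
  by rewrite mulmxnE !mxE !eqxx.
rewrite exchange_big/=.
transitivity (\sum_(i < m) ((2 ^ m)%:R : R)); last first.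
  by rewrite sumr_const card_ord mulr_natr.
apply: eq_bigr => i _; rewrite exchange_big/= (bigD1 i)//= [X in _ + X]big1 => [|j ji].
  by rewrite -mulr_suml sum_sign_mul !eqxx !mulr1 addr0.
by rewrite -mulr_suml sum_sign_mul eq_sym (negPf ji) mulr0 mul0r.
Qed.

Theorem theorem2p3 (R : realType) (N m : nat) (W : 'M[R]_N) (aM : R^nat)
    (S : 'I_m -> 'I_N)
    (m_gt0 : (0 < m)%N)
    (W_sym : W^T = W)
    (aM_ge0 : forall i, 0 <= aM i)
    (aM_cvg : cvgn (series (fun i : nat => aM i * spectral_radius W ^+ i))) :
  (empirical_rademacher S (hypothesis_set W aM) <=
   (Num.sqrt (m%:R^-1 *
      limn (series (fun i : nat => aM i * spectral_radius W ^+ i))))%:E)%E.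
Proof.
set B := limn _.
have B_ge0 : 0 <= B.
  apply: limr_ge => //; apply: nearW => n; rewrite /series/= sumr_ge0// => i _.
  by rewrite mulr_ge0// exprn_ge0// spectral_radius_ge0.
pose v (s : {ffun 'I_m -> bool}) : 'rV[R]_N :=
  sample_vector S (fun i => (-1) ^+ s i).
pose Q s := (v s *m (v s)^T) 0 0.
have Q_ge0 s : 0 <= Q s.
  by rewrite /Q mxE sumr_ge0// => i _; rewrite mxE -expr2 sqr_ge0.
pose p : R := \prod_(i < m) 2^-1.
have pE : p = (2 ^ m)%:R^-1 by rewrite /p prodr_const card_ord natrX exprVn.
have p_ge0 : 0 <= p by rewrite pE invr_ge0.
have pK : p * (2 ^ m)%:R = 1 by rewrite pE mulVf// pnatr_eq0 expn_eq0.
have m_neq0 : m%:R != 0 :> R by rewrite pnatr_eq0 -lt0n.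
apply: (@le_trans _ _ (m%:R^-1%:E * \sum_s (p * Num.sqrt (B * Q s))%:E)%E).
  rewrite /empirical_rademacher; apply: lee_wpmul2l; first by rewrite lee_fin invr_ge0.
  rewrite /rademacher_expectation; apply: lee_sum => s _; rewrite EFinM.
  apply: lee_wpmul2l; first by rewrite lee_fin.
  (* The bound [Num.sqrt (B * Q s)] is the same for all [a] and [w], hence bounds the supremum. *)
  apply: ge_ereal_sup => _ [h [a [w [a_le a_cvg K_psd [wK w_le1] ->]]] <-].
  rewrite lee_fin; apply: le_trans (rkhs_ball_eval_le _ _ K_psd wK w_le1) _.
  by rewrite ler_wsqrtr// kernel_quad_le.
rewrite sumEFin -EFinM lee_fin.
have p1 : \sum_(s : {ffun 'I_m -> bool}) p = 1.
  by rewrite sumr_const card_ffun card_bool card_ord -mulr_natr.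
apply: (@le_trans _ _ (m%:R^-1 * Num.sqrt (B * m%:R))).
  rewrite ler_wpM2l ?invr_ge0//.
  apply: le_trans (weighted_mean_le_sqrt _ (fun=> p_ge0) p1) _.
  rewrite ler_wsqrtr//; under eq_bigr => s _ do rewrite sqr_sqrtr ?mulr_ge0//.
  by rewrite -!mulr_sumr sum_sign_vector_sqnorm mulrCA !mulrA -(mulrA B) pK mulr1.
(* Moving [m%:R^-1] under the root squares it, and [m%:R^-1 ^+ 2 * (B * m%:R)] is [m%:R^-1 * B]. *)
rewrite -{1}[m%:R^-1]ger0_norm ?invr_ge0// -sqrtr_sqr -sqrtrM ?sqr_ge0//.
rewrite ler_wsqrtr// le_eqVlt; apply/orP; left; apply/eqP.
by field.
Qed.
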